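(* Let $n,k$ be positive integers with $n\ge 100k^2$, and let $\mathcal F\subset\binom{[n]}{k}$ with $|\mathcal F|>\binom{n-1}{k-1}$. Then $d(\mathcal F)\ge 0.49|\mathcal F|$.
   Context: $\binom{[n]}{k}$ is the family of $k$-subsets of $[n]$. For $\mathcal F\subset\binom{[n]}{k}$, $d(\mathcal F)=\max_{F\in\mathcal F}|\{G\in\mathcal F:G\cap F=\emptyset\}|$ (the maximum degree of the induced subgraph of the Kneser graph $KG(n,k)$ on $\mathcal F$). *)

(* Defs.v *)
From mathcomp Require Import all_boot all_order all_algebra.

Set Implicit Arguments.
Unset Strict Implicit.
Unset Printing Implicit Defensive.

Definition ksubsets (n k : nat) : {set {set 'I_n}} :=
  [set A : {set 'I_n} | #|A| == k].

(* For k > 0 and F \subset ksubsets n k, this is the maximum degree of the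
   subgraph of the Kneser graph KG(n, k) induced on F; it is 0 when F is empty. *)
Definition max_kneser_degree (n : nat) (F : {set {set 'I_n}}) : nat :=
  \max_(A in F) #|[set B in F | B :&: A == set0]|.

(* Main.v *)
(* Let m = |F| and suppose that every A in F meets more than 0.51 m members of
   F.  Write N2 for the number of k-sets through two given points, so that
   100 k N2 <= C(n-1,k-1) < m, and let x have maximal degree d in F.
   - If d >= m/2, take A in F avoiding x: A meets at most m - d members that
     avoid x and at most k N2 <= m/100 members through x.
   - If m/4 <= d < m/2, average over the members A of F through x: the pairs
     (A, B) of members meeting off x, with x in A but not in B, number at most
     N2 k (m - d), so some A meets at most d + (m - d) m/(100 d) <= 0.51 m.
   - If d < m/4, put Z(A) = sum of deg(y) over y in A, y != x.  By the union
     bound, every A in F through x has Z(A) > 0.51 m - d, whereas Z has mean at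
     most m/100 over all k-sets through x.  Its total squared deviation there
     is at most N2 sum_y deg(y)^2 <= N2 d k m <= d m^2/100, less than the
     d (m/4)^2 contributed by the members of F alone. *)
Require Import Defs.
From mathcomp Require Import all_boot all_order all_algebra.
From mathcomp Require Import zify ring lra.

Set Implicit Arguments.
Unset Strict Implicit.
Unset Printing Implicit Defensive.

Import Order.TTheory GRing.Theory Num.Theory.

(** * Supersets, degrees and meeting members in a set family *)

Section Families.
Variable T : finType.
Implicit Types (A B D : {set T}) (H : {set {set T}}) (x y : T) (k : nat).

Definition ksupersets k D : {set {set T}} :=
  [set A : {set T} | (#|A| == k) && (D \subset A)].

Definition star H y := [set B in H | y \in B].

Definition degree H y := #|star H y|.

Definition meeting H A := [set B in H | B :&: A != set0].

(** Complementation turns these sets into the subsets of [~: D] of size [#|T| - k]. *)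
Lemma card_ksupersets k D :
  k <= #|T| -> #|ksupersets k D| = 'C(#|T| - #|D|, #|T| - k).
Proof.
move=> le_kT; have cC (A : {set T}) : #|~: A| = #|T| - #|A| by rewrite -(cardsC A) addKn.
rewrite -cC -cards_draws -(card_imset (mem (ksupersets k D)) (@setC_inj T)).
congr #|pred_of_set _|; apply/setP=> B; rewrite [RHS]inE.
apply/imsetP/andP => [[A]|[sBD cB]].
  rewrite inE => /andP[/eqP cA sDA] ->.
  by rewrite setCS sDA cC cA eqxx.
exists (~: B); last by rewrite setCK.
by rewrite inE -setCS setCK sBD andbT cC (eqP cB) subKn.
Qed.

Lemma sum_weight H (w : T -> nat) :
  \sum_(A in H) \sum_(y in A) w y = \sum_y degree H y * w y.
Proof.
rewrite (exchange_big_dep predT) //=; apply: eq_bigr => y _.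
rewrite sum_nat_const; congr (_ * _).
by apply: eq_card => A; rewrite !inE.
Qed.

Lemma sum_degree k H :
  {in H, forall A, #|A| = k} -> \sum_y degree H y = k * #|H|.
Proof.
move=> Hk; under eq_bigr do rewrite -[degree _ _]muln1.
rewrite -sum_weight (eq_bigr (fun=> k)) => [|A HA]; last by rewrite sum1_card Hk.
by rewrite sum_nat_const mulnC.
Qed.

(** Union bound: the right side counts each [B] in [H] with weight [#|B :&: A|], which is at least 1
    when [B] meets [A]. *)
Lemma card_meeting_le H A : #|meeting H A| <= \sum_(y in A) degree H y.
Proof.
have -> : \sum_(y in A) degree H y = \sum_(B in H) #|B :&: A|.
  under eq_bigr do rewrite /degree -sum1_card.
  under [RHS]eq_bigr do rewrite -sum1_card.
  rewrite (exchange_big_dep (mem H)) => [|y B _]; last by rewrite inE => /andP[].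
  apply: eq_bigr => B /= HB; apply: eq_bigl => y.
  by rewrite !inE HB andbC.
rewrite -sum1_card; under eq_bigl do rewrite inE.
rewrite big_mkcondr /=; apply: leq_sum => B _.
by case: ifP => //; rewrite card_gt0.
Qed.

Lemma card_meeting_split H1 H A :
  #|meeting H A| <= #|meeting H1 A| + #|meeting (H :\: H1) A|.
Proof.
apply: leq_trans (leq_card_setU _ _); apply: subset_leq_card.
by apply/subsetP=> B; rewrite !inE => /andP[-> ->]; rewrite !andbT orbN.
Qed.

Lemma sub_meeting H A : meeting H A \subset H.
Proof. by apply/subsetP=> B; rewrite inE => /andP[]. Qed.

(** * Binomial counts of k-sets through given points *)

(* ['C(n - j, n - k)] counts the k-sets through j given points; unlike
   ['C(n - j, k - j)] it vanishes, as it should, when [k < j <= n]. *)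
Lemma link_binom n k : 0 < k <= n ->
  n.-1 * 'C(n - 2, n - k) = k.-1 * 'C(n - 1, n - k).
Proof.
move=> /andP[k_gt0 le_kn]; have := mul_bin_down (n - 1) (n - k).
have -> : (n - 1).-1 = n - 2 by lia.
have -> : n - 1 - (n - k) = k.-1 by lia.
by rewrite subn1.
Qed.

(** Multiplied by [(n - 2) * n.-1], both sides become multiples of [N1 * N2], and [k <= n] compares
    the factors. This controls the cross terms of the variance below. *)
Lemma link_binom_log_concave n k : 2 < n -> 0 < k <= n ->
  'C(n - 3, n - k) * 'C(n - 1, n - k) <= 'C(n - 2, n - k) ^ 2.
Proof.
move=> n_gt2 k_n; have := link_binom k_n; move: k_n => /andP[k_gt0 le_kn].
have := mul_bin_down (n - 2) (n - k).
have -> : (n - 2).-1 = n - 3 by lia.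
have -> : n - 2 - (n - k) = k - 2 by lia.
set N1 := 'C(n - 1, _); set N2 := 'C(n - 2, _); set N3 := 'C(n - 3, _) => e3 e2.
rewrite -(@leq_pmul2l ((n - 2) * n.-1)); last by rewrite muln_gt0; lia.
have -> : (n - 2) * n.-1 * (N3 * N1) = (k - 2) * n.-1 * (N1 * N2).
  transitivity (((n - 2) * N3) * (n.-1 * N1)); first ring.
  by rewrite e3; ring.
have -> : (n - 2) * n.-1 * N2 ^ 2 = (n - 2) * k.-1 * (N1 * N2).
  transitivity ((n - 2) * N2 * (n.-1 * N2)); first ring.
  by rewrite e2; ring.
apply: leq_mul => //; nia.
Qed.

Lemma degree_le k H x : k <= #|T| -> {in H, forall A, #|A| = k} ->
  degree H x <= 'C(#|T| - 1, #|T| - k).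
Proof.
move=> le_kT Hk; rewrite -(cards1 x) -card_ksupersets //.
apply: subset_leq_card; apply/subsetP=> A; rewrite !inE => /andP[HA xA].
by rewrite Hk ?eqxx // sub1set.
Qed.

Lemma degree_star_le k H x y :
    k <= #|T| -> {in H, forall A, #|A| = k} -> y != x ->
  degree (star H x) y <= 'C(#|T| - 2, #|T| - k).
Proof.
move=> le_kT Hk nyx.
have <- : #|[set x; y]| = 2 by rewrite cards2 eq_sym nyx.
rewrite -card_ksupersets //.
apply: subset_leq_card; apply/subsetP=> A; rewrite !inE -andbA.
by move=> /and3P[HA xA yA]; rewrite Hk ?eqxx // subUset !sub1set xA.
Qed.

(** * First and second moments over the k-sets through a point *)

Local Open Scope ring_scope.

Lemma sum_link k x (p : T -> rat) : (k <= #|T|)%N ->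
  \sum_(A in ksupersets k [set x]) \sum_(y in A | y != x) p y
  = 'C(#|T| - 2, #|T| - k)%:R * \sum_(y | y != x) p y.
Proof.
move=> le_kT; rewrite (exchange_big_dep (fun y => y != x)) => [|A y _ /andP[]//].
rewrite mulr_sumr; apply: eq_bigr => y nyx.
rewrite sumr_const -[LHS]mulr_natl; congr (_%:R * _).
have c2 : #|[set x; y]| = 2%N by rewrite cards2 eq_sym nyx.
rewrite -c2 -card_ksupersets //; apply: eq_card => A.
rewrite -[LHS]topredE /= !inE.
by rewrite nyx andbT -andbA subUset !sub1set.
Qed.

(** The square expands over pairs [(y, z)]: with [x], a diagonal pair spans two points and any other
    pair three. *)
Lemma sum_link_sqr k x (p : T -> rat) : (k <= #|T|)%N ->
  \sum_(A in ksupersets k [set x]) (\sum_(y in A | y != x) p y) ^+ 2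
  = 'C(#|T| - 2, #|T| - k)%:R * \sum_(y | y != x) p y ^+ 2
    + 'C(#|T| - 3, #|T| - k)%:R
      * ((\sum_(y | y != x) p y) ^+ 2 - \sum_(y | y != x) p y ^+ 2).
Proof.
move=> le_kT.
transitivity (\sum_(y | y != x) \sum_(z | z != x)
   #|ksupersets k [set x; y; z]|%:R * (p y * p z)).
  under eq_bigr do rewrite expr2 mulr_suml.
  rewrite (exchange_big_dep (fun y => y != x)) => [|A y _ /andP[]//].
  apply: eq_bigr => y nyx.
  under eq_bigr do rewrite mulr_sumr.
  rewrite (exchange_big_dep (fun y => y != x)) => [|A z _ /andP[]//].
  apply: eq_bigr => z nzx.
  rewrite sumr_const -[LHS]mulr_natl; congr (_%:R * _).
  apply: eq_card => A.
  rewrite -[LHS]topredE /= !inE.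
  by rewrite nyx nzx !andbT !subUset !sub1set !andbA.
rewrite (expr2 (\sum_(y | y != x) p y)) mulr_suml mulr_sumr -sumrB mulr_sumr -big_split /=.
apply: eq_bigr => y nyx.
rewrite (bigD1 y) //= [in RHS](bigD1 y) //= !card_ksupersets //.
have -> : #|[set x; y; y]| = 2%N by rewrite -setUA setUid cards2 eq_sym nyx.
rewrite -!expr2 [p y * (_ + _)]mulrDr -expr2; congr (_ + _).
rewrite [p y ^+ 2 + _]addrC addrK.
rewrite !mulr_sumr; apply: eq_bigr => z /andP[nzx nzy].
rewrite !card_ksupersets //.
suff -> : #|[set x; y; z]| = 3%N by [].
by rewrite setUC cardsU1 cards2 !inE negb_or nzx nzy eq_sym nyx.
Qed.

(** Here [c] is the mean of the inner sum. By log-concavity the term [N3 * S ^+ 2] of the second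
    moment is at most [c ^+ 2 * N1], which centring subtracts. *)
Lemma link_variance_le k x (p : T -> rat) (c : rat) : (2 < #|T|)%N -> (0 < k <= #|T|)%N ->
  c = 'C(#|T| - 2, #|T| - k)%:R / 'C(#|T| - 1, #|T| - k)%:R
      * \sum_(y | y != x) p y ->
  \sum_(A in ksupersets k [set x]) (\sum_(y in A | y != x) p y - c) ^+ 2
  <= 'C(#|T| - 2, #|T| - k)%:R * \sum_(y | y != x) p y ^+ 2.
Proof.
move=> T_gt2 /andP[k_gt0 le_kT]; set S := \sum_(y | y != x) p y => def_c.
under eq_bigr do rewrite sqrrB.
rewrite big_split sumrB /= sum_link_sqr // -/S sumrMnl -mulr_suml sum_link // -/S.
rewrite sumr_const card_ksupersets // cards1.
have N1_gt0 : (0 < 'C(#|T| - 1, #|T| - k))%N by rewrite bin_gt0; lia.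
have lc : ('C(#|T| - 3, #|T| - k) * 'C(#|T| - 1, #|T| - k)
           <= 'C(#|T| - 2, #|T| - k) ^ 2)%N.
  by apply: link_binom_log_concave; rewrite ?k_gt0.
have P_ge0 : 0 <= \sum_(y | y != x) p y ^+ 2 by apply: sumr_ge0 => y _; apply: sqr_ge0.
move: N1_gt0 lc P_ge0 def_c; set P := \sum_(y | y != x) p y ^+ 2.
set N1 := 'C(_ - 1, _); set N2 := 'C(_ - 2, _); set N3 := 'C(_ - 3, _).
rewrite -(ltr0n rat) -(ler_nat rat) natrM natrX => N1_gt0 lc P_ge0 def_c.
have cN1 : c * N1%:R = N2%:R * S by rewrite def_c mulrAC divfK // gt_eqF.
have N3_ge0 : 0 <= N3%:R :> rat by apply: ler0n.
have : N3%:R * S ^+ 2 <= c * N2%:R * S.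
  rewrite -(ler_pM2r N1_gt0).
  have -> : c * N2%:R * S * N1%:R = N2%:R ^+ 2 * S ^+ 2.
    transitivity (c * N1%:R * (N2%:R * S)); first ring.
    by rewrite cN1; ring.
  rewrite mulrAC; apply: ler_wpM2r => //; exact: sqr_ge0.
have := mulr_ge0 N3_ge0 P_ge0.
rewrite -[c ^+ 2 *+ N1]mulr_natr expr2 -(mulrA c c) cN1 mulrBr; lra.
Qed.

Close Scope ring_scope.

(** * Degrees when every member meets more than 51% of the family *)

Section IntersectingHalf.
Variables (k : nat) (F : {set {set T}}).
Hypothesis k_gt0 : 0 < k.
Hypothesis T_large : 100 * k ^ 2 <= #|T|.
Hypothesis F_unif : {in F, forall A, #|A| = k}.
Hypothesis F_large : 'C(#|T| - 1, #|T| - k) < #|F|.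
Hypothesis F_meet : {in F, forall A, 51 * #|F| < 100 * #|meeting F A|}.

Let le_kT : k <= #|T|. Proof. by move: T_large k_gt0; nia. Qed.

Let T_gt2 : 2 < #|T|. Proof. by move: T_large k_gt0; nia. Qed.

Let k_bounds : 0 < k <= #|T|. Proof. by rewrite k_gt0. Qed.

Lemma codegree_small :
  100 * (k * 'C(#|T| - 2, #|T| - k)) <= 'C(#|T| - 1, #|T| - k).
Proof.
have := link_binom k_bounds.
set N1 := 'C(#|T| - 1, _); set N2 := 'C(#|T| - 2, _) => e.
(* The factor [k.-1] cannot be cancelled when [k = 1]; then no k-set contains two points. *)
have [k1|k_gt1] := leqP k 1.
  have N2_0 : N2 = 0 by move: e T_gt2; nia.
  by rewrite N2_0 !muln0.
rewrite -(@leq_pmul2l k.-1); last lia.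
rewrite -e mulnCA mulnA mulnA leq_mul2r; apply/orP; right.
by move: T_large k_gt1; nia.
Qed.

Lemma star_setD_degree x : degree (F :\: star F x) x = 0.
Proof.
apply/eqP; rewrite cards_eq0; apply/eqP/setP=> A; rewrite !inE.
by case: (A \in F); case: (x \in A).
Qed.

Lemma card_setD_star x : #|F :\: star F x| = #|F| - degree F x.
Proof.
rewrite cardsD (setIidPr _) //.
by apply/subsetP=> A; rewrite inE => /andP[].
Qed.

Lemma degree_lt_half x : 2 * degree F x < #|F|.
Proof.
rewrite ltnNge; apply/negP=> large_x.
have d_lt := leq_ltn_trans (degree_le x le_kT F_unif) F_large.
(* The star of [x] has at most ['C(#|T| - 1, #|T| - k)] members, fewer than [F]. *)
have [A FA xA] : exists2 A, A \in F & x \notin A.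
  have: 0 < #|F :\: star F x| by rewrite card_setD_star subn_gt0.
  move=> /card_gt0P[A]; rewrite !inE => /andP[nA FA]; exists A => //.
  by move: nA; rewrite FA.
have meet_star : #|meeting (star F x) A| <= k * 'C(#|T| - 2, #|T| - k).
  apply: leq_trans (card_meeting_le _ _) _.
  rewrite -(F_unif FA) -sum_nat_const; apply: leq_sum => y yA.
  rewrite F_unif //; apply: degree_star_le => //.
  by apply: contraNneq xA => <-.
have meet_rest : #|meeting (F :\: star F x) A| <= #|F| - degree F x.
  by rewrite -card_setD_star subset_leq_card ?sub_meeting.
have := F_meet FA; have := card_meeting_split (star F x) F A.
have := codegree_small; lia.
Qed.

Lemma degree_lt_quarter x : 4 * degree F x < #|F|.
Proof.
rewrite ltnNge; apply/negP=> large_x; have half_x := degree_lt_half x.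
set d := degree F x in large_x half_x; set m := #|F| in large_x half_x.
set N2 := 'C(#|T| - 2, #|T| - k).
have starF A : A \in star F x -> A \in F by rewrite inE => /andP[].
have lower : d * (51 * m).+1 <= 100 * \sum_(A in star F x) #|meeting F A|.
  rewrite -sum_nat_const big_distrr /=.
  by apply: leq_sum => A /starF FA; apply: F_meet.
(* At most [d] members through [x] meet [A]; those avoiding [x] are handled by the union bound and
   double counting. *)
have upper : \sum_(A in star F x) #|meeting F A| <= d * d + N2 * (k * (m - d)).
  apply: (@leq_trans (\sum_(A in star F x)
    (d + \sum_(y in A) degree (F :\: star F x) y))).
    apply: leq_sum => A SA; apply: leq_trans (card_meeting_split (star F x) _ _) _.
    by rewrite leq_add ?card_meeting_le // subset_leq_card ?sub_meeting.
  rewrite big_split /= sum_nat_const leq_add2l sum_weight.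
  rewrite -card_setD_star -(@sum_degree k) => [|A /setDP[/F_unif]//].
  rewrite big_distrr /=; apply: leq_sum => y _.
  have [->|nyx] := eqVneq y x; first by rewrite star_setD_degree muln0.
  by rewrite leq_mul2r degree_star_le ?orbT.
have small : 100 * (k * N2) <= m := leq_trans codegree_small (ltnW F_large).
have : 100 * (N2 * (k * (m - d))) <= m * (m - d).
  have -> : 100 * (N2 * (k * (m - d))) = 100 * (k * N2) * (m - d) by ring.
  by rewrite leq_mul2r small orbT.
have {}upper := leq_trans lower (leq_mul (leqnn 100) upper).
move: (N2 * _) upper => t upper le_t.
have {upper le_t} : d * (51 * m).+1 <= 100 * (d * d) + m * (m - d) by lia.
(* In terms of [e = m - 2 * d] the inequality reads [48 * d * e + d <= e * e], while [m <= 4 * d]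
   gives [e <= 2 * d]. *)
have [e e_gt0 def_m] : exists2 e, 0 < e & m = 2 * d + e by exists (m - 2 * d); lia.
have ee_le : e * e <= 2 * d * e by rewrite leq_mul2r; lia.
have de_gt0 : 0 < d * e by rewrite muln_gt0 e_gt0; lia.
rewrite def_m (_ : 2 * d + e - d = d + e); last lia.
nia.
Qed.

Lemma max_degree_ge_quarter x :
  (forall y, degree F y <= degree F x) -> #|F| <= 4 * degree F x.
Proof.
move=> max_x; rewrite leqNgt; apply/negP=> small_x.
have sumd := sum_degree F_unif.
have m_gt0 : 0 < #|F| by apply: leq_ltn_trans F_large.
have d_gt0 : 0 < degree F x.
  rewrite lt0n; apply/negP=> /eqP d0; move: sumd.
  rewrite big1 => [|y _]; last by apply/eqP; rewrite -leqn0 -d0.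
  by move: k_gt0 m_gt0; nia.
move: sumd; rewrite (bigD1 x) //= => sumd.
pose p y := (degree F y)%:R%R : rat.
set N1 := 'C(#|T| - 1, #|T| - k); set N2 := 'C(#|T| - 2, #|T| - k).
have N1_gt0 : 0 < N1 by rewrite bin_gt0; lia.
(* The mean, over all k-sets through [x], of the degree sum off [x]. *)
pose c := (N2%:R / N1%:R * \sum_(y | y != x) p y)%R.
have := @link_variance_le k x p c T_gt2 k_bounds erefl; rewrite -/N2 => variance.
have small : 100 * (k * N2) <= N1 := codegree_small.
have N1_lt : N1 < #|F| := F_large.
have cN1 : (c * N1%:R = N2%:R * \sum_(y | y != x) p y)%R.
  by rewrite /c mulrAC divfK // gt_eqF // ltr0n.
clearbody N1 N2 c.
have S_le : (\sum_(y | y != x) p y <= k%:R * #|F|%:R)%R.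
  by rewrite -natr_sum -natrM ler_nat -sumd leq_addl.
have c_le : (100%:R * c <= #|F|%:R)%R.
  have N1_gt0_rat : (0 < N1%:R :> rat)%R by rewrite ltr0n.
  rewrite -(ler_pM2r N1_gt0_rat) -mulrA cN1.
  have le_NS := ler_wpM2l (ler0n rat N2) S_le.
  have : 100 * (k * N2) * #|F| <= N1 * #|F| by rewrite leq_mul2r small orbT.
  rewrite -(ler_nat rat) !natrM; move: le_NS; lra.
(* The constants fit exactly: 0.51 - 0.25 - 0.01 = 1/4, for the union bound, the degree of [x] and
   the mean. *)
have Z_ge A : A \in star F x ->
    (#|F|%:R / 4%:R <= \sum_(y in A | y != x) p y - c)%R.
  rewrite inE => /andP[FA xA].
  have le_sum := card_meeting_le F A; rewrite (bigD1 x xA) in le_sum.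
  have meet_A : 51 * #|F| <= 100 * (degree F x + \sum_(y in A | y != x) degree F y).
    by apply: leq_trans (ltnW (F_meet FA)) _; rewrite leq_mul2l le_sum.
  have : (51%:R * #|F|%:R <= 100%:R * (p x + \sum_(y in A | y != x) p y))%R.
    by rewrite -natr_sum -natrD -!natrM ler_nat.
  have : (4%:R * p x <= #|F|%:R)%R by rewrite -natrM ler_nat ltnW.
  move: c_le; lra.
have lower : ((degree F x)%:R * (#|F|%:R / 4%:R) ^+ 2
    <= \sum_(A in ksupersets k [set x]) (\sum_(y in A | y != x) p y - c) ^+ 2)%R.
  rewrite (big_setID (star F x)) /= (setIidPr _); last first.
    apply/subsetP=> A; rewrite !inE sub1set => /andP[/F_unif-> ->].
    by rewrite eqxx.
  (* The k-sets through [x] outside [F] only add squares. *)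
  apply: ler_wpDr; first by apply: sumr_ge0 => A _; apply: sqr_ge0.
  rewrite mulr_natl -sumr_const; apply: ler_sum => A /Z_ge ge_Z.
  have : (0 <= #|F|%:R / 4%:R :> rat)%R by rewrite divr_ge0 ?ler0n.
  by move=> m4_ge0; rewrite !expr2; apply: ler_pM.
(* Maximality of the degree of [x] bounds one factor of each square. *)
have sqr_le : (\sum_(y | y != x) p y ^+ 2 <= p x * (k%:R * #|F|%:R))%R.
  apply: (@le_trans _ _ (p x * \sum_(y | y != x) p y))%R; last first.
    by rewrite ler_wpM2l // ler0n.
  rewrite mulr_sumr; apply: ler_sum => y _; rewrite expr2.
  by apply: ler_wpM2r; [apply: ler0n|rewrite ler_nat].
move: variance => /(le_trans lower) /le_trans /(_ (ler_wpM2l (ler0n _ _) sqr_le)).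
have -> : (N2%:R * (p x * (k%:R * #|F|%:R)) = p x * (k%:R * N2%:R * #|F|%:R))%R by ring.
have px_gt0 : (0 < p x)%R by rewrite ltr0n.
rewrite (ler_pM2l px_gt0).
(* With [p x] cancelled, [#|F| ^ 2 / 16] would be at most [#|F| ^ 2 / 100]. *)
have : 100 * (k * N2) * #|F| <= #|F| * #|F|.
  by rewrite leq_mul2r (leq_trans small (ltnW N1_lt)) orbT.
rewrite -(ler_nat rat) !natrM.
have : (0 < #|F|%:R :> rat)%R by rewrite ltr0n.
nra.
Qed.

End IntersectingHalf.

End Families.

(** * Derivation of the bound by contradiction *)

Theorem theorem8 (n k : nat) (n_gt0 : 0 < n) (k_gt0 : 0 < k)
    (n_large : 100 * k ^ 2 <= n)
    (F : {set {set 'I_n}}) (F_sub : F \subset ksubsets n k)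
    (F_large : 'C(n.-1, k.-1) < #|F|) :
  ((49%:R / 100%:R : rat) * #|F|%:R <= (max_kneser_degree F)%:R)%R.
Proof.
suff: 49 * #|F| <= 100 * max_kneser_degree F.
  rewrite -(ler_nat rat) !natrM; lra.
rewrite leqNgt; apply/negP=> small.
have F_unif : {in F, forall A : {set 'I_n}, #|A| = k}.
  by move=> A /(subsetP F_sub); rewrite inE => /eqP.
(* Fewer than 49% of the members are disjoint from [A], so more than 51% meet it. *)
have F_meet : {in F, forall A : {set 'I_n}, 51 * #|F| < 100 * #|meeting F A|}.
  move=> A FA.
  have dA : #|[set B in F | B :&: A == set0]| <= max_kneser_degree F.
    exact: (@leq_bigmax_cond _ (mem F) (fun A => #|[set B in F | B :&: A == set0]|)).
  have : #|F| = #|meeting F A| + #|[set B in F | B :&: A == set0]|.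
    rewrite -(cardsID (meeting F A) F) (setIidPr (sub_meeting _ _)); congr (_ + #|pred_of_set _|).
    by apply/setP=> B; rewrite !inE; case: (B \in F); rewrite // negbK andbT.
  lia.
have le_kn : k <= n by nia.
have F_large' : 'C(#|'I_n| - 1, #|'I_n| - k) < #|F|.
  rewrite card_ord; apply: leq_ltn_trans F_large.
  rewrite -(@bin_sub n.-1 k.-1); last by lia.
  have -> : n.-1 - k.-1 = n - k by lia.
  by rewrite subn1.
have n_large' : 100 * k ^ 2 <= #|'I_n| by rewrite card_ord.
(* At a point of maximal degree the two quarter bounds contradict each other. *)
have [x _ max_x] := @arg_maxnP _ (Ordinal n_gt0) predT (degree F) isT.
have := degree_lt_quarter k_gt0 n_large' F_unif F_large' F_meet x.
have := max_degree_ge_quarter k_gt0 n_large' F_unif F_large' F_meet (fun y => max_x y isT).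
lia.
Qed.
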